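(* The minimal constant $C_1(2)>0$ for which $$\sum_{n=1}^\infty a_n\leq C_1(2)\sum_{n=1}^\infty\left(\frac{1}{n}\sum_{k=n}^\infty a_k^2\right)^{\frac{1}{2}}$$ holds for all sequences $(a_n)_{n\in\mathbb{N}}\in\ell_2$ of nonnegative real numbers is at most $1.1086983$.
   Context: $\mathbb{N}=\{1,2,3,\ldots\}$. Sums of nonnegative terms take values in $[0,\infty]$. $\ell_2$ is the space of square-summable sequences. *)

(* Defs.v *)
From mathcomp Require Import all_boot all_order all_algebra.
From mathcomp Require Import all_classical all_reals all_analysis.

Set Implicit Arguments.
Unset Strict Implicit.
Unset Printing Implicit Defensive.

Import Order.TTheory GRing.Theory Num.Theory.
Import numFieldNormedType.Exports.

Local Open Scope classical_set_scope.
Local Open Scope ring_scope.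

(* Sequences are indexed by {1, 2, 3, ...}: the value [a 0] is never used, and
   all sums are taken in the extended reals. *)

Definition nonneg_seq (R : realType) (a : nat -> R) : Prop :=
  forall n : nat, (1 <= n)%N -> 0 <= a n.

Definition ell2 (R : realType) (a : nat -> R) : Prop :=
  (\sum_(1 <= n <oo) (a n ^+ 2)%:E < +oo)%E.

Definition C1_admissible (R : realType) : set R :=
  [set C : R | 0 < C /\
    forall a : nat -> R, nonneg_seq a -> ell2 a ->
      (\sum_(1 <= n <oo) (a n)%:E <=
       C%:E * \sum_(1 <= n <oo)
         ((n%:R^-1)%:E * \sum_(n <= k <oo) (a k ^+ 2)%:E) `^ 2^-1)%E].

Definition is_minimum (R : realType) (A : set R) (x : R) : Prop :=
  A x /\ lbound A x.

(* Main.v *)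
Require Import Defs.
From mathcomp Require Import all_boot all_order all_algebra.
From mathcomp Require Import all_classical all_reals all_analysis.
From mathcomp Require Import ring lra.

Set Implicit Arguments.
Unset Strict Implicit.
Unset Printing Implicit Defensive.

Import Order.TTheory GRing.Theory Num.Theory.
Import numFieldNormedType.Exports.

Local Open Scope classical_set_scope.
Local Open Scope ring_scope.

(** Write [A n] for the square root of the tail [sum_(k >= n) a_k^2], so that
    [a_n = sqrt (A_n^2 - A_(n+1)^2)] and the inequality to prove is
    [sum a_n <= C * sum A_n / sqrt n].  The function [sqrt (x^2 - y^2)] is
    concave and homogeneous on the cone [0 <= y <= x], hence lies below each of
    its tangents: it is at most [p x - q y] as soon as [p^2 >= 1 + q^2]
    ([hyperbolic_tangent]).

    Take a sequence of nonnegative weights [q_0 = 0, q_1, q_2, ...] and use at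
    the index [n] the tangent with slopes [p_n = q_(n-1) + C / sqrt n] and
    [q_n].  The terms [q_(n-1) A_n - q_n A_(n+1)] telescope, and what is left is
    exactly [C * sum A_n / sqrt n] ([tangents_telescope]).  So [C] is admissible
    whenever there are weights with
    [1 + q_n^2 <= (q_(n-1) + C / sqrt n)^2] for all [n >= 1].

    For weights of the form [q_n = b sqrt (n + s)] this recursion holds to
    leading order when [b^2 - 2 C b + 1 = 0], that is [2 C = b + 1/b].  With
    [b = 63/100] this gives [C = 1.10865...], just below the required bound, and
    with the shift [s = -11/20] the recursion is true from [n = 4] on
    ([slope_recursion]).  The first two weights are rational numbers slightly
    below the values for which the recursion would be an equality.

    The least admissible constant exists because the admissible constants form
    a closed set: for a fixed sequence with finite positive right-hand sum [S]
    and left-hand sum [X], the quotient [X / S] is a lower bound of this set,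
    hence is at most its infimum.  The infimum is positive, since the sequence
    [1, 0, 0, ...] forces every admissible constant to be at least [1]. *)

(** * The tangent weights *)

(** With [p^2 = 1 + q^2 + d] and [a^2 = x^2 - y^2], the difference of squares
    [(p x - q y)^2 - a^2] equals [(q x - p y)^2 + d a^2]. *)
Lemma hyperbolic_tangent (R : realType) (p q x y a : R) :
  0 <= p -> 0 <= q -> 1 + q ^+ 2 <= p ^+ 2 -> 0 <= x -> 0 <= y ->
  x ^+ 2 = a ^+ 2 + y ^+ 2 -> a <= p * x - q * y.
Proof.
move=> p0 q0 pq x0 y0 xay.
have qp : q <= p by rewrite -ler_sqr ?nnegrE//; apply: le_trans pq; rewrite lerDr.
have yx : y <= x by rewrite -ler_sqr ?nnegrE// xay lerDr sqr_ge0.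
have pxqy : 0 <= p * x - q * y by rewrite subr_ge0 ler_pM.
rewrite (le_trans (ler_norm a))// -ler_sqr ?nnegrE// real_normK ?num_real//.
have -> : (p * x - q * y) ^+ 2 =
  (q * x - p * y) ^+ 2 + (p ^+ 2 - q ^+ 2) * (x ^+ 2 - y ^+ 2) by ring.
rewrite xay addrK ler_wpDl ?sqr_ge0// ler_peMl ?sqr_ge0//.
by rewrite lerBrDr.
Qed.

(** The constant below is smallest at slope [1], but smaller slopes are needed:
    the weights of asymptotic slope [b] must be reached from [q_0 = 0]. *)
Definition slope (R : realType) : R := 63 / 100.

Definition constant (R : realType) : R := (slope R + (slope R)^-1) / 2.

Definition weight (R : realType) (n : nat) : R :=
  match n with
  | 0 => 0
  | 1 => 478 / 1000
  | 2 => 769 / 1000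
  | _ => slope R * Num.sqrt (n%:R - 11 / 20)
  end.

Lemma constant_ge1 (R : realType) : 1 <= constant R.
Proof. rewrite /constant /slope; lra. Qed.

Lemma weight_ge0 (R : realType) n : 0 <= weight R n.
Proof.
case: n => [|[|[|n]]]; rewrite /weight; [lra|lra|lra|].
by rewrite mulr_ge0 ?sqrtr_ge0// /slope; lra.
Qed.

(** Let [b] be the slope and [C] the constant, so that [2 b C = 1 + b^2].  After
    expanding the square and dividing by [1 + b^2], the claim becomes
    [1 - k / m <= sqrt (m - 31/20) / sqrt m] with
    [k = (1 + b^2) / (4 b^2) = 0.8798...].  The squares of the two sides are
    [1 - 2 k / m + k^2 / m^2] and [1 - (31/20) / m]; as [2 k > 31/20], the
    claim holds once [m] is large enough, and [m >= 4] suffices. *)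
Lemma slope_recursion (R : realType) (m : R) : 4 <= m ->
  1 + (slope R * Num.sqrt (m - 11 / 20)) ^+ 2 <=
  (slope R * Num.sqrt (m - 31 / 20) + constant R / Num.sqrt m) ^+ 2.
Proof.
move=> m4.
have m0 : 0 < m by lra.
have sm0 : 0 < Num.sqrt m by rewrite sqrtr_gt0.
have m1 : 0 <= m^-1 <= 4^-1.
  by rewrite invr_ge0 ltW//= lef_pV2 ?posrE//; lra.
set u := Num.sqrt (m - 31 / 20); set v := (Num.sqrt m)^-1.
have u0 : 0 <= u by exact: sqrtr_ge0.
have v0 : 0 <= v by rewrite invr_ge0 ltW.
have u2 : u ^+ 2 = m - 31 / 20 by rewrite sqr_sqrtr//; lra.
have v2 : v ^+ 2 = m^-1 by rewrite exprVn sqr_sqrtr// ltW.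
rewrite exprMn sqr_sqrtr; last by lra.
rewrite sqrrD !exprMn u2 v2.
(* 87/100 is a lower bound of [k] for which the same estimate holds. *)
have uv : 1 - 87 / 100 * m^-1 <= u * v.
  rewrite -ler_sqr ?nnegrE ?mulr_ge0//; last by lra.
  rewrite exprMn u2 v2 mulrBl mulfV ?gt_eqF//.
  by clear -m1; nra.
by move: uv m1; rewrite /constant /slope; clear; lra.
Qed.

Lemma weight_recursion (R : realType) n :
  1 + weight R n.+1 ^+ 2 <=
  (weight R n + constant R / Num.sqrt n.+1%:R) ^+ 2.
Proof.
have invsqrt (c d : R) : 0 <= c -> 0 < d -> c ^+ 2 * d <= 1 ->
    c <= (Num.sqrt d)^-1.
  move=> c0 d0 cd.
  rewrite -ler_sqr ?nnegrE ?invr_ge0 ?sqrtr_ge0// exprVn sqr_sqrtr; last exact: ltW.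
  by move: cd; rewrite -ler_pdivlMr// div1r.
have C0 : 0 <= constant R by apply: le_trans (constant_ge1 R).
have step (p q c d : R) : 0 <= q -> 0 <= c -> 0 < d -> c ^+ 2 * d <= 1 ->
    1 + p ^+ 2 <= (q + constant R * c) ^+ 2 ->
    1 + p ^+ 2 <= (q + constant R / Num.sqrt d) ^+ 2.
  move=> q0 c0 d0 cd /le_trans; apply.
  have qc : q + constant R * c <= q + constant R / Num.sqrt d.
    by rewrite lerD2l ler_wpM2l// invsqrt.
  have qc0 : 0 <= q + constant R * c by rewrite addr_ge0// mulr_ge0.
  by rewrite ler_sqr ?nnegrE// (le_trans qc0).
case: n => [|[|[|n]]]; rewrite /weight.
- by apply: (step _ _ 1); rewrite /constant /slope; lra.
- (* 707/1000 < 1 / sqrt 2 *)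
  by apply: (step _ _ (707 / 1000)); rewrite /constant /slope; lra.
- (* 577/1000 < 1 / sqrt 3 *)
  apply: (step _ _ (577 / 1000)); [lra|lra|lra|lra|].
  rewrite exprMn sqr_sqrtr; last by lra.
  by rewrite /constant /slope; lra.
have n4 : (4 : R) <= n.+4%:R by rewrite ler_nat.
have := slope_recursion n4.
by have -> : n.+4%:R - 31 / 20 = n.+3%:R - 11 / 20 :> R by rewrite -natr1; lra.
Qed.

(** * The inequality for the constant of the weights *)

Lemma tangents_telescope (R : realType) (a A : nat -> R) :
  (forall n, 0 <= A n) ->
  (forall n, (1 <= n)%N -> A n ^+ 2 = a n ^+ 2 + A n.+1 ^+ 2) ->
  forall N, \sum_(1 <= n < N.+1) a n + weight R N * A N.+1 <=
            constant R * \sum_(1 <= n < N.+1) A n / Num.sqrt n%:R.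
Proof.
move=> A0 aA; elim=> [|N IH]; first by rewrite !big_geq// mul0r mulr0 addr0.
have recr (f : nat -> R) :
    \sum_(1 <= n < N.+2) f n = \sum_(1 <= n < N.+1) f n + f N.+1.
  exact: big_nat_recr.
rewrite !recr mulrDr.
have p0 : 0 <= weight R N + constant R / Num.sqrt N.+1%:R.
  rewrite addr_ge0 ?weight_ge0// divr_ge0 ?sqrtr_ge0//.
  exact: le_trans (constant_ge1 R).
have := hyperbolic_tangent p0 (weight_ge0 R N.+1) (weight_recursion R N)
  (A0 N.+1) (A0 N.+2) (aA N.+1 isT).
move: IH; rewrite (mulrDl _ _ (A N.+1)) (mulrAC (constant R)).
by rewrite -(mulrA (constant R)); lra.
Qed.

Section Tails.
Context {R : realType} (a : nat -> R).

Let tail n : \bar R := (\sum_(n <= k <oo) (a k ^+ 2)%:E)%E.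

Let tail_ge0 n : (0 <= tail n)%E.
Proof. by apply: nneseries_ge0 => k _ _; rewrite lee_fin sqr_ge0. Qed.

Let tailS n : tail n = ((a n ^+ 2)%:E + tail n.+1)%E.
Proof.
rewrite /tail (nneseries_split _ 1); last by move=> k _; rewrite lee_fin sqr_ge0.
by rewrite addn1 big_nat1.
Qed.

Lemma tail_fin_num : ell2 a -> forall n, (1 <= n)%N ->
  (\sum_(n <= k <oo) (a k ^+ 2)%:E)%E \is a fin_num.
Proof.
move=> a2; case=> // n _; rewrite ge0_fin_numE; last exact: tail_ge0.
elim: n => // n; apply: le_lt_trans.
by rewrite -/(tail _) -/(tail _) (tailS n.+1) leeDr// lee_fin sqr_ge0.
Qed.

Definition tail_norm n := Num.sqrt (fine (\sum_(n <= k <oo) (a k ^+ 2)%:E)%E).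

Lemma tail_norm_recursion n : ell2 a -> (1 <= n)%N ->
  tail_norm n ^+ 2 = a n ^+ 2 + tail_norm n.+1 ^+ 2.
Proof.
move=> a2 n1; rewrite /tail_norm !sqr_sqrtr ?fine_ge0 ?tail_ge0//.
by rewrite -/(tail _) -/(tail _) tailS fineD// tail_fin_num.
Qed.

Lemma averaged_tail_norm n : ell2 a -> (1 <= n)%N ->
  (((n%:R^-1)%:E * \sum_(n <= k <oo) (a k ^+ 2)%:E) `^ 2^-1)%E =
  (tail_norm n / Num.sqrt n%:R)%:E.
Proof.
move=> a2 n1; rewrite -(fineK (tail_fin_num a2 n1)) -EFinM poweR_EFin.
rewrite powR12_sqrt; last by rewrite mulr_ge0 ?invr_ge0// fine_ge0 ?tail_ge0.
by rewrite mulrC sqrtrM ?fine_ge0 ?tail_ge0// sqrtrV.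
Qed.

End Tails.

Lemma constant_admissible (R : realType) : C1_admissible (constant R).
Proof.
have C0 : 0 < constant R by apply: lt_le_trans (constant_ge1 R).
split=> // a a0 a2.
apply: lime_le.
  by apply: is_cvg_nneseries => n n1 _; rewrite lee_fin a0.
apply: nearW => -[|N].
  rewrite big_geq// mule_ge0 ?lee_fin ?(ltW C0)//.
  by apply: nneseries_ge0 => n _ _; exact: poweR_ge0.
apply: (@le_trans _ _ ((constant R)%:E *
    \sum_(1 <= n < N.+1) ((n%:R^-1)%:E * \sum_(n <= k <oo) (a k ^+ 2)%:E)
       `^ 2^-1)%E); last first.
  rewrite lee_pmul2l//; apply: nneseries_lim_ge => n _ _; exact: poweR_ge0.
under [X in (_ <= _ * X)%E]eq_big_nat => n /andP[n1 _].
  by rewrite (averaged_tail_norm a2 n1); over.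
rewrite !sumEFin -EFinM lee_fin.
apply: le_trans (tangents_telescope _ (fun n => tail_norm_recursion a2) N).
  by rewrite lerDl mulr_ge0 ?weight_ge0 ?sqrtr_ge0.
by move=> n; exact: sqrtr_ge0.
Qed.

(** * Existence of the least constant *)

Lemma admissible_ge1 (R : realType) : lbound (@C1_admissible R) 1.
Proof.
move=> C [C0 adm]; pose e n : R := (n == 1%N)%:R.
have sum1 (f : nat -> \bar R) : (forall n, (2 <= n)%N -> f n = 0)%E ->
    (0 <= f 1%N)%E -> (\sum_(1 <= n <oo) f n = f 1%N)%E.
  move=> f0 f1; rewrite (nneseries_split 1 1) ?big_nat1 ?eseries0 ?adde0//.
    by move=> n n2 _; exact: f0.
  by case=> [|[|n]]// _; rewrite f0.
have tail1 : (\sum_(1 <= n <oo) (e n ^+ 2)%:E = 1)%E.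
  by rewrite sum1 /e ?eqxx ?expr1n// => -[|[|n]] //= _; rewrite expr0n.
have tail0 n : (2 <= n)%N ->
    (((n%:R^-1)%:E * \sum_(n <= k <oo) (e k ^+ 2)%:E) `^ 2^-1 = 0)%E.
  move=> n2; rewrite eseries0 ?mule0 ?poweR0r ?invr_neq0//.
  by case=> [|[|k]] nk _; rewrite /e ?expr0n//; move: (leq_trans n2 nk).
have := adm e (fun n _ => ler0n _ _).
rewrite /ell2 tail1 ltry => /(_ isT).
rewrite sum1 ?lee_fin => [|[|[|n]]//|]; last exact: ler0n.
rewrite sum1 => [|n /tail0->//|]; last exact: poweR_ge0.
by rewrite tail1 invr1 mule1 poweR_EFin powR1 mule1 lee_fin.
Qed.

Lemma inf_admissible (R : realType) :
  C1_admissible (inf (@C1_admissible R)).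
Proof.
set E := @C1_admissible R.
have E1 : 1 <= inf E.
  apply: lb_le_inf (@admissible_ge1 R).
  by exists (constant R); exact: constant_admissible.
have C0 : 0 < inf E by apply: lt_le_trans E1.
split=> // a a0 a2.
set X := (\sum_(1 <= n <oo) (a n)%:E)%E; set S := (\sum_(_ <= _ <oo) _)%E.
have XS C : E C -> (X <= C%:E * S)%E by case=> _; exact.
have S0 : (0 <= S)%E by apply: nneseries_ge0 => n _ _; exact: poweR_ge0.
have X0 : (0 <= X)%E by apply: nneseries_ge0 => n n1 _; rewrite lee_fin a0.
have XD := XS _ (constant_admissible R).
move: S0 XS XD; case: S => [s||//]; last by move=> _ _ _; rewrite gt0_muley ?leey.
rewrite lee_fin le_eqVlt => /predU1P[<- _|s0 XS XD].
  by rewrite !mule0.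
have Xfin : X \is a fin_num by rewrite ge0_fin_numE// (le_lt_trans XD)// ltry.
rewrite -(fineK Xfin) -EFinM lee_fin -ler_pdivrMr//.
(* It remains to see that [X / S] is a lower bound of the admissible set. *)
apply: lb_le_inf; first by exists (constant R); exact: constant_admissible.
by move=> C /XS; rewrite -(fineK Xfin) -EFinM lee_fin ler_pdivrMr.
Qed.

(* The bound is 1.1086983 = 1 + 0.1086 + 0.0000983; it is split because a large
   numeral would be expanded to a unary natural number. *)
Theorem corollary2p6 (R : realType) :
  exists C : R, is_minimum (@C1_admissible R) C /\
    C <= 1 + 1086 / 10 ^+ 4 + 983 / 10 ^+ 7.
Proof.
have inf_lb : lbound (@C1_admissible R) (inf (@C1_admissible R)).
  by apply: ge_inf; exists 1; exact: admissible_ge1.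
exists (inf (@C1_admissible R)); split; first by split; [exact: inf_admissible|].
apply: le_trans (inf_lb _ (constant_admissible R)) _.
rewrite /constant /slope; lra.
Qed.
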